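(* Let $X=T=[0,1]$, equipped with the Lebesgue measure, denoted by $m$ on $X$ and $p$ on $T$. Let $f_0:X\to X$ be a measurable map and let $f:T\times X\to X$, $f(t,x)=f_t(x)$, be the random map $$f_t(x)=\begin{cases}0&\text{for }x=0,\\ f_0(x)+t\pmod 1&\text{for }x\ne0.\end{cases}$$ Let $P(x,A)$ and $\mathcal L_f$ be the transition probability and the annealed Perron--Frobenius operator associated with $f$. Then $\mathcal L_f$ satisfies (UC), but $P(x,A)$ does not satisfy (D).
   Context: $P(x,A)=p(\{t\in T:f_t(x)\in A\})$ for $x\in X$ and Borel $A\subset X$. The $n$-th transition probabilities are given by $P^1=P$, $P^n(x,A)=\int P^{n-1}(y,A)\,P(x,dy)$. $\mathcal L_f:L^1(m)\to L^1(m)$ is the operator such that $\mathcal L_f\varphi$ is the Radon--Nikodym derivative with respect to $m$ of $A\mapsto\int\varphi(x)P(x,A)\,dm(x)$. (When every $f_t$ is nonsingular, this is $\int\mathcal L_t\varphi\,dp(t)$ with $\mathcal L_t$ the Perron--Frobenius operator of $f_t$.) $D(m)=\{h\in L^1(m):h\ge0\ m\text{-a.e.},\ \|h\|=1\}$. (UC) (uniformly constrictive), for an operator $Q$ on $L^1(m)$: there is a compact set $F\subset L^1(m)$ with $\lim_{n\to\infty}\sup_{h\in D(m)}\inf_{\psi\in F}\|Q^nh-\psi\|=0$. (D), for a transition probability $P(x,A)$: there exist $n_0\ge1$, $0<\varepsilon<1$, $\delta>0$ and a probability measure $\mu$ absolutely continuous with respect to $m$ such that $P^{n_0}(x,A)<\varepsilon$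 for all $x\in X$ and all Borel $A$ with $\mu(A)<\delta$. *)

(* Defs.v *)
From HB Require Import structures.
From mathcomp Require Import all_boot all_order all_algebra.
From mathcomp Require Import all_classical all_reals all_analysis.
From mathcomp Require Import measurable_realfun.

Set Implicit Arguments.
Unset Strict Implicit.
Unset Printing Implicit Defensive.

Import Order.TTheory GRing.Theory Num.Theory.
Import numFieldNormedType.Exports.

Local Open Scope classical_set_scope.
Local Open Scope ring_scope.
Local Open Scope ereal_scope.

(* The quotient type LspaceType1 carries no topology in the library; the alias
   L1 adds the metric of the norm 'N[mu]_1. *)
Section L1_space.
Context d (X : measurableType d) (R : realType).
Variable mu : {measure set X -> \bar R}.

Definition L1 : Type := LspaceType1 mu.

HB.instance Definition _ := gen_eqMixin L1.
HB.instance Definition _ := gen_choiceMixin L1.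

Definition L1_fun (f : L1) : X -> R := f.

Lemma measurable_L1_fun (f : L1) : measurable_fun [set: X] (L1_fun f).
Proof. exact: (@measurable_funPT _ _ _ _ (repr (LebesgueSpace.sort f))). Qed.

Lemma L1_integrable (f : L1) : mu.-integrable [set: X] (EFin \o L1_fun f).
Proof.
apply/integrableP; split; first exact/measurable_EFinP/measurable_L1_fun.
have := @Lebesgue_finite _ _ _ _ _ _ f.
by rewrite /finite_norm Lnorm1.
Qed.

Lemma L1_eqP (f g : L1) : L1_fun f = L1_fun g %[ae mu] -> f = g.
Proof.
move=> fg; have : LebesgueSpace.sort f = LebesgueSpace.sort g.
  have /eqP := introT (@ae_eqP _ _ _ _ _ mu (LebesgueSpace.sort f)
    (LebesgueSpace.sort g)) fg.
  by rewrite !reprK.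
case: f g {fg} => [f [[pf]]] [g [[pg]]] /= fg.
by move: pf; rewrite fg => pf; congr (LebesgueSpace.Pack _);
  congr (LebesgueSpace.Class _); congr (isFinLebesgue.Axioms_ _ _);
  exact: Prop_irrelevance.
Qed.

Definition L1_norm (g : X -> R) : \bar R := 'N[mu]_1[EFin \o g].

Definition L1_dist (f g : L1) : R := fine (L1_norm (L1_fun f \- L1_fun g)%R).

Lemma L1_distE (f g : L1) :
  (L1_dist f g)%:E = \int[mu]_x `|L1_fun f x - L1_fun g x|%:E.
Proof.
rewrite /L1_dist /L1_norm Lnorm1 fineK//.
have /integrableP[_] :=
  integrableB measurableT (L1_integrable f) (L1_integrable g).
by move=> h; rewrite ge0_fin_numE ?integral_ge0//; exact: h.
Qed.

Let measurable_dist (f g : L1) :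
  measurable_fun [set: X] (fun x => `|L1_fun f x - L1_fun g x|%:E).
Proof.
apply/measurable_EFinP/measurableT_comp => //.
by apply: measurable_funB; exact: measurable_L1_fun.
Qed.

Let L1_distxx (f : L1) : L1_dist f f = 0%R.
Proof.
apply: EFin_inj; rewrite L1_distE.
by under eq_integral do rewrite subrr normr0; rewrite integral0.
Qed.

Let L1_dist_eq0 (f g : L1) : L1_dist f g = 0%R -> f = g.
Proof.
move=> fg; apply: L1_eqP.
have mfg : measurable_fun [set: X] (EFin \o (L1_fun f \- L1_fun g)%R).
  by apply/measurable_EFinP/measurable_funB; exact: measurable_L1_fun.
have := L1_distE f g; rewrite fg => /esym fg0.
have fg1 : 'N[mu]_1[EFin \o (L1_fun f \- L1_fun g)%R] = 0 by rewrite Lnorm1.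
have := Lnorm_eq0_eq0 mfg lte01 fg1.
apply: filterS => x /(_ I)/= + _.
by move=> /eqP; rewrite eqe subr_eq0 => /eqP.
Qed.

Let L1_dist_sym (f g : L1) : L1_dist f g = L1_dist g f.
Proof.
by apply: EFin_inj; rewrite !L1_distE; under eq_integral do rewrite distrC.
Qed.

Let L1_dist_triangle (g f h : L1) :
  (L1_dist f h <= L1_dist f g + L1_dist g h)%R.
Proof.
rewrite -lee_fin EFinD !L1_distE -ge0_integralD//.
apply: ge0_le_integral => //.
- by apply: emeasurable_funD.
- by move=> x _; rewrite -EFinD lee_fin ler_distD.
Qed.

HB.instance Definition _ := @isMetric.Build R L1 L1_dist
  L1_distxx L1_dist_eq0 L1_dist_sym L1_dist_triangle.

Section L1_class.
Variable g : X -> R.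
Hypothesis ig : mu.-integrable [set: X] (EFin \o g).

Let mg : measurable_fun [set: X] g.
Proof. by apply/measurable_EFinP; exact: measurable_int ig. Qed.

Let mfg : {mfun X >-> measurableTypeR R} :=
  @mfun_Sub _ _ X (measurableTypeR R) g (mem_set mg).

Let cl : {mfun_ mu, X >-> measurableTypeR R} :=
  @generic_quotient.pi _ _ mfg.

Let cl_ae : (repr cl : X -> R) = g %[ae mu].
Proof.
have : (repr cl == mfg %[mod {mfun_ mu, X >-> measurableTypeR R}])%qT.
  by rewrite reprK.
by rewrite eqmodE => /asboolP.
Qed.

Let cl_fin : finite_norm mu 1 (cl : X -> R).
Proof.
have mcl : measurable_fun [set: X] (repr cl : X -> R).
  exact: (@measurable_funPT _ _ _ _ (repr cl)).
rewrite /finite_norm Lnorm1.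
have /integrableP[_] := ig.
rewrite (ae_eq_integral (fun x => `|(EFin \o (repr cl : X -> R)) x|))//.
- by do 2 apply: measurableT_comp => //.
- by do 2 apply: measurableT_comp => //.
- by move: cl_ae; apply: filterS => x /= + _ => /(_ I) ->.
Qed.

Definition L1_class : L1 :=
  HB.pack_for (LspaceType mu (lexx 1%E)) cl
    (@isFinLebesgue.Build d X R mu 1 (lexx 1%E) cl cl_fin).

Lemma L1_classE : L1_fun L1_class = g %[ae mu].
Proof. exact: cl_ae. Qed.

End L1_class.
End L1_space.

Coercion L1_fun : L1 >-> Funclass.

Section annealed_operator.
Context d (X : measurableType d) (R : realType).
Variables (m : probability X R) (P : R.-pker X ~> X).

(* A |-> \int phi(x) P(x, A) dm(x) *)
Definition annealed_charge (phi : L1 m) (A : set X) : \bar R :=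
  \int[m]_x ((phi x)%:E * P x A).

Section charge.
Variable phi : L1 m.

Let P_le1 x A : measurable A -> P x A <= 1.
Proof.
move=> mA; rewrite -(@prob_kernel _ _ _ _ _ P x).
by apply: le_measure; rewrite ?inE.
Qed.

Let integrable_phiP A : measurable A ->
  m.-integrable [set: X] (fun x => (phi x)%:E * P x A).
Proof.
move=> mA; apply: le_integrable (L1_integrable phi) => //.
- apply: emeasurable_funM; last exact: measurable_kernel.
  by apply/measurable_EFinP; exact: measurable_L1_fun.
- move=> x _ /=; rewrite abseM -[leRHS]mule1 lee_wpmul2l//.
  by rewrite gee0_abs// P_le1.
Qed.

Let charge0 : annealed_charge phi set0 = 0.
Proof.
rewrite /annealed_charge.
by under eq_integral do rewrite measure0 mule0; rewrite integral0.
Qed.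

Let charge_fin A : measurable A -> annealed_charge phi A \is a fin_num.
Proof. by move=> mA; apply: integrable_fin_num => //; exact: integrable_phiP. Qed.

Let charge_sigma : semi_sigma_additive (annealed_charge phi).
Proof.
move=> F mF tF mUF.
have -> : (fun n => \sum_(0 <= i < n) annealed_charge phi (F i)) =
    (fun n => \int[m]_x ((phi x)%:E * \sum_(0 <= i < n) P x (F i))).
  apply/funext => n; rewrite /annealed_charge -integral_sum//.
    by apply: eq_integral => x _; rewrite ge0_sume_distrr.
  by move=> i; exact: integrable_phiP.
have sumE n x : \sum_(0 <= i < n) P x (F i) = P x (\big[setU/set0]_(i < n) F i).
  by rewrite measure_semi_additive// ?big_mkord//; exact: bigsetU_measurable.
apply: (@dominated_cvg _ _ _ m _ measurableT _ _
  (fun x => `|(phi x)%:E|)) => //.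
- move=> n; under eq_fun do rewrite sumE.
  by apply: (measurable_int m); apply: integrable_phiP; exact: bigsetU_measurable.
- move=> x _; apply: cvgeZl => //.
  exact: measure_semi_sigma_additive.
- by apply: integrable_abse; exact: L1_integrable.
- move=> n x _; rewrite sumE abseM -[leRHS]mule1 lee_wpmul2l//.
  by rewrite gee0_abs// P_le1//; exact: bigsetU_measurable.
Qed.

HB.instance Definition _ := isCharge.Build _ _ _ (annealed_charge phi)
  charge0 charge_fin charge_sigma.

Definition annealed_density : X -> \bar R :=
  Radon_Nikodym (annealed_charge phi) m.

Lemma annealed_density_integrable :
  m.-integrable [set: X] (EFin \o (fine \o annealed_density)).
Proof.
have [num|nnum] := pselect (annealed_charge phi `<< m).
  apply: eq_integrable (Radon_Nikodym_integrable num) => // x _ /=.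
  by rewrite fineK// Radon_Nikodym_fin_num.
rewrite (_ : _ \o _ = cst 0) ?integrable0//; apply/funext => x /=.
by rewrite /annealed_density /Radon_Nikodym; case: pselect.
Qed.

End charge.

(* Condition for annealed_PF to be given by genuine Radon-Nikodym derivatives:
   Radon_Nikodym returns the junk value -oo outside of it, and annealed_PF 0. *)
Definition annealed_nonsingular := forall phi : L1 m, annealed_charge phi `<< m.

Definition annealed_PF (phi : L1 m) : L1 m :=
  L1_class (annealed_density_integrable phi).

End annealed_operator.
Arguments annealed_PF {d X R} m P phi.

Section conditions.
Context d (X : measurableType d) (R : realType).
Variable m : probability X R.

Definition densities : set (L1 m) :=
  [set h | (\forall x \ae m, 0 <= h x)%R /\ L1_norm m h = 1].

(* The supremum and infimum are taken in \bar R, so that F = set0 is excluded. *)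
Definition uniformly_constrictive (Q : L1 m -> L1 m) :=
  exists2 F : set (L1 m), compact F &
    ereal_sup [set ereal_inf [set L1_norm m (iter n Q h \- psi)%R | psi in F]
              | h in densities] @[n --> \oo] --> 0.

(* P^n for n >= 1; the value at n = 0 is a convention that is not used. *)
Fixpoint transition_iter (P : X -> {measure set X -> \bar R}) (n : nat)
    (x : X) (A : set X) : \bar R :=
  match n with
  | 0 => \d_x A
  | 1 => P x A
  | (k.+1 as n').+1 => \int[P x]_y transition_iter P n' y A
  end.

Definition condition_D (P : X -> {measure set X -> \bar R}) :=
  exists (n0 : nat) (e delta : R) (mu : probability X R),
    [/\ (1 <= n0)%N, (0 < e < 1)%R, (0 < delta)%R, mu `<< m &
      forall (x : X) (A : set X), measurable A -> mu A < delta%:E ->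
        transition_iter P n0 x A < e%:E].

End conditions.
Arguments uniformly_constrictive {d X R} m Q.

Section transition_probability.
Context d d' (T : measurableType d) (X : measurableType d') (R : realType).
Variables (p : probability T R) (f : {mfun (T * X)%type >-> X}).

Definition transition_prob (x : X) (A : set X) : \bar R :=
  p [set t | A (f (t, x))].

Section measure.
Variable x : X.

Let mfx : measurable_fun [set: T] (fun t => f (t, x)).
Proof. exact: measurable_fun_pair1. Qed.

Let tp0 : transition_prob x set0 = 0. Proof. exact: measure0. Qed.

Let tp_ge0 A : 0 <= transition_prob x A. Proof. exact: measure_ge0. Qed.

Let tp_sigma : semi_sigma_additive (transition_prob x).
Proof.
exact: (@measure_semi_sigma_additive _ _ _
  (pushforward p (fun t => f (t, x)))).
Qed.

HB.instance Definition _ := isMeasure.Build _ _ _ (transition_prob x)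
  tp0 tp_ge0 tp_sigma.

End measure.

Definition transition_kernel (x : X) : {measure set X -> \bar R} :=
  transition_prob x.

Let measurable_transition U : measurable U ->
  measurable_fun [set: X] (transition_kernel ^~ U).
Proof.
move=> mU; have mfU : measurable (f @^-1` U).
  by rewrite -[X in measurable X]setTI; exact: measurable_funPT.
rewrite (_ : _ ^~ U = p \o ysection (f @^-1` U)).
  exact: measurable_fun_ysection.
apply/funext => x /=; rewrite /transition_kernel/= /transition_prob.
by congr (p _); apply/seteqP; split => t; rewrite /ysection/= inE.
Qed.

HB.instance Definition _ := isKernel.Build _ _ _ _ R transition_kernel
  measurable_transition.

Let transition_setT x : transition_kernel x [set: X] = 1.
Proof.
rewrite /transition_kernel/= /transition_prob -[RHS](probability_setT p).
by congr (p _); apply/seteqP; split.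
Qed.

HB.instance Definition _ := Kernel_isProbability.Build _ _ _ _ R
  transition_kernel transition_setT.

End transition_probability.

Section unit_interval.
Variable R : realType.

Definition unit_interval : Type := {x : R | (0 <= x <= 1)%R}.
HB.instance Definition _ := SubType.on unit_interval.
HB.instance Definition _ := Choice.on unit_interval.

Definition unit_val (x : unit_interval) : R := val x.

Definition unit0 : unit_interval :=
  exist _ 0%R (introT andP (conj (lexx 0%R) ler01)).

HB.instance Definition _ := isPointed.Build unit_interval unit0.

HB.instance Definition _ := Measurable.copy unit_interval
  (g_sigma_algebra_preimageType (unit_val : unit_interval -> measurableTypeR R)).

Lemma measurable_unit_val : measurable_fun [set: unit_interval] unit_val.
Proof. by move=> _ B mB; exists B. Qed.

Lemma measurable_fun_unit d (T : measurableType d) (g : T -> unit_interval) :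
  measurable_fun [set: T] (unit_val \o g) -> measurable_fun [set: T] g.
Proof.
move=> mg _ _ [B mB <-].
have := mg measurableT B mB.
by rewrite !setTI.
Qed.

Lemma measurable_image_unit_val (A : set unit_interval) :
  measurable A -> measurable (unit_val @` A).
Proof.
move=> [B mB <-]; rewrite setTI.
suff -> : unit_val @` (unit_val @^-1` B) = B `&` `[0%R, 1%R].
  by apply: measurableI => //; exact: measurable_itv.
apply/seteqP; split => [_ [x Bx <-]|x [Bx x01]].
  by split => //=; rewrite in_itv/=; exact: (valP x).
by move: x01; rewrite /= in_itv/= => x01; exists (exist _ x x01).
Qed.

(* Trace of the Lebesgue measure of R on the Borel sets of [0, 1]. *)
Definition lebesgue01 (A : set unit_interval) : \bar R :=
  lebesgue_measure (unit_val @` A).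

Let leb0 : lebesgue01 set0 = 0.
Proof. by rewrite /lebesgue01 image_set0 measure0. Qed.

Let leb_ge0 A : 0 <= lebesgue01 A. Proof. exact: measure_ge0. Qed.

Let leb_sigma : semi_sigma_additive lebesgue01.
Proof.
move=> F mF tF mUF; rewrite /lebesgue01 image_bigcup.
apply: measure_semi_sigma_additive.
- by move=> n; exact: measurable_image_unit_val.
- apply/trivIsetP => i j _ _ ij; apply/seteqP; split => // _ [[x Fx <-]].
  move=> [y Fy /val_inj yx]; rewrite {}yx in Fy.
  move/trivIsetP : tF => /(_ _ _ I I ij) /seteqP[+ _].
  by move=> /(_ x); apply.
- by rewrite -image_bigcup; exact: measurable_image_unit_val.
Qed.

HB.instance Definition _ := isMeasure.Build _ _ _ lebesgue01
  leb0 leb_ge0 leb_sigma.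

Let leb_setT : lebesgue01 [set: unit_interval] = 1.
Proof.
rewrite /lebesgue01 (_ : _ @` _ = `[0%R, 1%R]%classic).
  by rewrite lebesgue_measure_itv/= lte_fin ltr01 sube0.
apply/seteqP; split => [_ [x _ <-]|x x01]/=.
  by rewrite in_itv/=; exact: (valP x).
by move: x01; rewrite /= in_itv/= => x01; exists (exist _ x x01).
Qed.

HB.instance Definition _ := Measure_isProbability.Build _ _ _
  lebesgue01 leb_setT.

Let frac_itv01 (r : R) : (0 <= r - (Num.floor r)%:~R <= 1)%R.
Proof.
rewrite subr_ge0 floor_le lerBlDl ltW//.
by have := floorD1_gt r; rewrite intrD.
Qed.

(* r mod 1, with values in [0, 1[ *)
Definition mod1 (r : R) : unit_interval :=
  exist _ (r - (Num.floor r)%:~R)%R (frac_itv01 r).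

Lemma measurable_mod1 : measurable_fun [set: R] mod1.
Proof.
apply: measurable_fun_unit; apply: measurable_funB => //.
apply: nondecreasing_measurable => //.
by move=> x y xy; rewrite ler_int; exact: le_floor.
Qed.

Section random_map.
Variable f0 : {mfun unit_interval >-> unit_interval}.

(* The argument is the pair (t, x) in T * X. *)
Definition shift_map (tx : (unit_interval * unit_interval)%type) :
    unit_interval :=
  if tx.2 == unit0 then unit0 else mod1 (unit_val (f0 tx.2) + unit_val tx.1).

Let measurable_shift_map : measurable_fun setT shift_map.
Proof.
have m0 : measurable ([set unit0] : set unit_interval).
  exists [set 0%R] => //; apply/seteqP; split => [x [_ x0]|x ->]//.
  exact/val_inj.
apply: measurable_fun_ifT => //.
- apply: (measurable_fun_bool true).
  rewrite (_ : _ @^-1` _ = setT `*` [set unit0]) ?setTI.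
    exact: measurableX.
  by apply/seteqP; split => [x /eqP|x [_ /= ->]]//; exact: eqxx.
- apply: (measurableT_comp measurable_mod1); apply: measurable_funD.
    by do 2 apply: measurableT_comp => //; exact: measurable_unit_val.
  by apply: measurableT_comp => //; exact: measurable_unit_val.
Qed.

HB.instance Definition _ := isMeasurableFun.Build _ _ _ _ shift_map
  measurable_shift_map.

End random_map.
End unit_interval.

(* Main.v *)
Require Import Defs.
From HB Require Import structures.
From mathcomp Require Import all_boot all_order all_algebra.
From mathcomp Require Import all_classical all_reals all_analysis.
From mathcomp Require Import measurable_realfun ring lra.

Set Implicit Arguments.
Unset Strict Implicit.
Unset Printing Implicit Defensive.

Import Order.TTheory GRing.Theory Num.Theory.
Import numFieldNormedType.Exports.

Local Open Scope classical_set_scope.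
Local Open Scope ring_scope.

(** For x <> 0 the image f_0(x) + t mod 1 of a uniform t is uniform on the
    circle, so P(x, .) = m (lebesgue01_rotation, which rests on the translation
    invariance of the Lebesgue measure of the line). The one exceptional point 0
    is m-null, and the two conditions differ in whether they see it.

    (UC) is about classes modulo m. The charge A |-> \int phi(x) P(x, A) dm(x)
    is (\int phi dm) m(A) whatever happens on a null set (annealed_chargeE), so
    L_f phi is the constant \int phi dm (annealed_PF_cst). Every density is
    thus sent to the constant density 1 in one step, and the singleton {1} is a
    compact set that witnesses (UC).

    (D) is a condition on all points x. The point 0 is absorbing,
    P^n(0, {0}) = 1 for all n, while mu({0}) = 0 < delta for every mu
    absolutely continuous with respect to m; hence P^{n0}(0, {0}) < 1 fails for
    A = {0} (not_condition_D). *)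

(** * Uniformity of a rotated uniform point *)

(** By uniqueness of the Lebesgue measure it suffices to compare lengths of
    half-open intervals. *)
Lemma lebesgue_measure_shift (R : realType) (c : R) (A : set R) :
  measurable A ->
  lebesgue_measure ((fun s : R => s + c) @^-1` A) = lebesgue_measure A.
Proof.
have mshift : measurable_fun [set: R]
    ((fun s => s + c) : R -> measurableTypeR R).
  by apply: measurable_funD.
pose mf := @mfun_Sub _ _ R (measurableTypeR R) (fun s => s + c)
  (mem_set mshift).
move=> mA; apply/esym.
apply: (lebesgue_measure_unique (mu := pushforward lebesgue_measure mf)) => //.
move=> _ [[a b]] _ <-.
have shift_itv : (fun s : R => s + c) @^-1` `]a, b]%classic =
    `](a - c)%R, (b - c)%R]%classic.
  by apply/seteqP; split => s /=; rewrite !in_itv/= ltrBlDr lerBrDr.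
rewrite -[RHS]/(lebesgue_measure ((fun s : R => s + c) @^-1` `]a, b]%classic)).
rewrite shift_itv !lebesgue_measure_itv/= !lte_fin ltrD2r.
by case: ifP => // _; rewrite -!EFinB opprB addrA subrK.
Qed.

Lemma lebesgue_measureD1 (R : realType) (a : R) (E : set R) : measurable E ->
  lebesgue_measure (E `\ a) = lebesgue_measure E.
Proof.
move=> mE; apply/esym.
apply: etrans (measureDI (@lebesgue_measure R) mE (measurable_set1 a)) _.
rewrite [X in (_ + X)%E](_ : _ = 0%E) ?adde0//.
apply: (@subset_measure0 _ (measurableTypeR R) R lebesgue_measure _
  [set a]) => //.
- exact: measurableI.
- exact: lebesgue_measure_set1.
Qed.

Lemma lebesgue01_set1 (R : realType) (x : unit_interval R) :
  lebesgue01 [set x] = 0%E.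
Proof. by rewrite /lebesgue01 image_set1 lebesgue_measure_set1. Qed.

Lemma measurable_unit_set1 (R : realType) (x : unit_interval R) :
  measurable [set x].
Proof.
exists [set unit_val x]; first exact: measurable_set1.
rewrite setTI; apply/seteqP; split => [y yx|y ->]//.
exact/val_inj.
Qed.

Lemma unit_val_mod1 (R : realType) (r : R) (n : int) :
  n%:~R <= r < n%:~R + 1 -> unit_val (mod1 r) = r - n%:~R.
Proof. by move=> rn; rewrite -(@floor_def _ r n)// intrD. Qed.

(** Rotation by a exchanges two intervals: it translates [0, 1 - a[ onto
    [a, 1[ and [1 - a, 1[ onto [0, a[, so that translation invariance applies to
    each half of A. The end point 1, which mod1 never reaches and which would
    break these bijections, is discarded on both sides as a null set. *)
Lemma lebesgue01_rotation (R : realType) (a : unit_interval R)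
    (A : set (unit_interval R)) : measurable A ->
  lebesgue01 [set t | A (mod1 (unit_val a + unit_val t))] = lebesgue01 A.
Proof.
move=> mA; set S := [set t | _].
have mS : measurable S.
  rewrite -[S]setTI; apply: (_ : measurable_fun _ _) => //.
  apply: (measurableT_comp (@measurable_mod1 R)).
  by apply: measurable_funD => //; exact: measurable_unit_val.
rewrite /lebesgue01.
have mSv := measurable_image_unit_val mS.
have mAv := measurable_image_unit_val mA.
set c := unit_val a; have /andP[c0 c1] : 0 <= c <= 1 := valP a.
rewrite -(lebesgue_measureD1 1 mSv) -(lebesgue_measureD1 1 mAv).
set B := (@unit_val R) @` A in mAv *.
have AB y : A y = B (unit_val y).
  by apply/propext; split => [Ay|[z Az /val_inj <-]//]; exists y.
have mlo : measurable (B `&` `[0, c[%classic) by exact: measurableI.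
have mhi : measurable (B `&` `[c, 1[%classic) by exact: measurableI.
have lebU (E F : set R) : measurable E -> measurable F -> E `&` F = set0 ->
    lebesgue_measure (E `|` F) = (lebesgue_measure E + lebesgue_measure F)%E.
  exact: (measureU (@lebesgue_measure R)).
have -> : B `\ 1 = (B `&` `[0, c[%classic) `|` (B `&` `[c, 1[%classic).
  apply/seteqP; split => [x [Bx /eqP x1]|x []].
  - have [y _ yx] := Bx.
    have /andP[x0 xle1] : 0 <= x <= 1 by rewrite -yx; exact: (valP y).
    have [xc|cx] := ltP x c; [left|right]; split => //=; rewrite in_itv/=.
      by rewrite x0.
    by rewrite cx lt_neqAle x1.
  - move=> [Bx]; rewrite /= in_itv/= => /andP[_ xc]; split => //=.
    by apply/eqP; rewrite lt_eqF// (lt_le_trans xc).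
  - move=> [Bx]; rewrite /= in_itv/= => /andP[_ x1]; split => //=.
    by apply/eqP; rewrite lt_eqF.
have SE : (@unit_val R @` S) `\ 1 =
    ((fun s => s + (c - 1)) @^-1` (B `&` `[0, c[%classic)) `|`
    ((fun s => s + c) @^-1` (B `&` `[c, 1[%classic)).
  apply/seteqP; split => [s [[t St <-] /eqP t1]|s []].
  - have /andP[t0 tle1] : 0 <= unit_val t <= 1 := valP t.
    have {tle1}t1 : unit_val t < 1 by rewrite lt_neqAle t1.
    move: St; rewrite /S/= AB -/c; have [ct|ct] := ltP (c + unit_val t) 1.
      rewrite (@unit_val_mod1 _ _ 0) => [Bt|]; last by apply/andP; split; lra.
      right; rewrite addrC; split; first by rewrite subr0 in Bt.
      by rewrite /= in_itv/=; apply/andP; split; lra.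
    rewrite (@unit_val_mod1 _ _ 1) => [Bt|]; last by apply/andP; split; lra.
    left; rewrite addrCA addrA; split => //.
    by rewrite /= in_itv/=; apply/andP; split; lra.
  - move=> [Bs]; rewrite /= in_itv/= => /andP[s0 sc].
    have s01 : 0 <= s <= 1 by apply/andP; split; lra.
    split; last by move=> /= s1; lra.
    exists (exist _ s s01) => //; rewrite /S/= AB (@unit_val_mod1 _ _ 1).
      by rewrite -/c [_ - _](_ : _ = s + (c - 1))// /unit_val/=; ring.
    by rewrite -/c /unit_val/=; apply/andP; split; lra.
  - move=> [Bs]; rewrite /= in_itv/= => /andP[s0 sc].
    have s01 : 0 <= s <= 1 by apply/andP; split; lra.
    split; last by move=> /= s1; lra.
    exists (exist _ s s01) => //; rewrite /S/= AB (@unit_val_mod1 _ _ 0).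
      by rewrite -/c [_ - _](_ : _ = s + c)// /unit_val/=; ring.
    by rewrite -/c /unit_val/=; apply/andP; split; lra.
have mshift (r : R) (E : set R) : measurable E ->
    measurable ((fun s => s + r) @^-1` E).
  by move=> mE; rewrite -[X in measurable X]setTI; apply: measurable_funD.
rewrite SE !lebU ?lebesgue_measure_shift//; try exact: mshift.
- by apply/seteqP; split => // x [[_ +] [_ +]]; rewrite /= !in_itv/=; lra.
- by apply/seteqP; split => // x [[_ +] [_ +]]; rewrite /= !in_itv/=; lra.
Qed.

(** * Kernels that almost everywhere equal the reference measure *)

Section L1_cst.
Context d (X : measurableType d) (R : realType) (m : probability X R).

Definition L1_cst (c : R) : L1 m :=
  L1_class (finite_measure_integrable_cst m c measurableT).

Lemma L1_cstE (c : R) : L1_cst c = cst c %[ae m].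
Proof. exact: L1_classE. Qed.

Lemma L1_cst1_density : densities (L1_cst 1).
Proof.
split; first by move: (L1_cstE 1); apply: filterS => x /(_ I) ->.
rewrite /L1_norm Lnorm1.
transitivity (\int[m]_x (cst 1%E x))%E.
  apply: ae_eq_integral => //.
    exact/measurableT_comp/measurable_EFinP/measurable_L1_fun.
  by move: (L1_cstE 1); apply: filterS => x /(_ I) x1 _ /=; rewrite x1 normr1.
by rewrite integral_cst// mul1e; exact: probability_setT.
Qed.

Lemma density_Rintegral (h : L1 m) : densities h -> \int[m]_x h x = 1.
Proof.
move=> [h0]; rewrite /L1_norm Lnorm1 => h1.
rewrite /Rintegral -[RHS]/(fine 1%E) -h1; congr fine.
apply: ae_eq_integral => //.
- exact/measurable_EFinP/measurable_L1_fun.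
- exact/measurableT_comp/measurable_EFinP/measurable_L1_fun.
- by move: h0; apply: filterS => x hx _ /=; rewrite ger0_norm.
Qed.

End L1_cst.

Section annealed_cst.
Context d (X : measurableType d) (R : realType).
Variables (m : probability X R) (P : R.-pker X ~> X).
Hypothesis Pm : forall A, measurable A -> \forall x \ae m, P x A = m A.

(** The integral against m ignores the null set of x on which P x A and m A
    differ, and the constant m A can be taken out. *)
Lemma annealed_chargeE (phi : L1 m) A : measurable A ->
  annealed_charge P phi A = ((\int[m]_x phi x)%:E * m A)%E.
Proof.
move=> mA; rewrite /annealed_charge.
have iphi := L1_integrable phi.
have mphi : measurable_fun [set: X] (EFin \o phi) := measurable_int _ iphi.
transitivity (\int[m]_x ((phi x)%:E * m A))%E.
  apply: ae_eq_integral => //.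
  - by apply: emeasurable_funM => //; exact: measurable_kernel.
  - by apply: emeasurable_funM.
  - by move: (Pm mA); apply: filterS => x PxA _; rewrite PxA.
have mAfin : m A \is a fin_num by exact: fin_num_measure.
rewrite -(fineK mAfin) integralZr// /Rintegral fineK//.
exact: integrable_fin_num.
Qed.

Lemma annealed_nonsingular_of_ae : annealed_nonsingular m P.
Proof.
move=> phi; apply/null_content_dominatesP => A mA mA0.
by rewrite annealed_chargeE// mA0 mule0.
Qed.

(** The constant is a density of the annealed charge, and Radon-Nikodym
    derivatives are unique up to a null set. *)
Lemma annealed_PF_cst (phi : L1 m) :
  annealed_PF m P phi = L1_cst m (\int[m]_x phi x).
Proof.
apply: L1_eqP.
have num := annealed_nonsingular_of_ae phi.
have iRN := Radon_Nikodym_integrable num.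
have := L1_cstE m (\int[m]_x phi x).
have := L1_classE (annealed_density_integrable P phi).
have : ae_eq m [set: X] (annealed_density P phi)
    (cst (\int[m]_x phi x)%:E).
  apply: integral_ae_eq => // A _ mA.
  by rewrite -Radon_Nikodym_integral// integral_cst//; exact: annealed_chargeE.
apply: filterS3 => x /(_ I) RNx /(_ I) Lx /(_ I) cx _.
by rewrite Lx cx /= RNx.
Qed.

End annealed_cst.

(** As g is itself a density, all iterates of Q from the first one on send every
    density to g, so {g} is a compact attractor reached after one step. That the
    set of densities is nonempty also matters: the supremum of the distances
    would otherwise be -oo instead of 0. *)
Lemma uniformly_constrictive_cst d (X : measurableType d) (R : realType)
    (m : probability X R) (Q : L1 m -> L1 m) (g : L1 m) :
  densities g -> (forall h, densities h -> Q h = g) ->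
  uniformly_constrictive m Q.
Proof.
move=> dg Qg; exists [set g]; first exact: compact_set1.
apply: cvg_near_cst; exists 1%N => // -[//|n] _.
have dist0 h : densities h ->
    ereal_inf [set L1_norm m (iter n.+1 Q h \- psi) | psi in [set g]] = 0%E.
  move=> dh; have -> : iter n.+1 Q h = g.
    elim: n => [|n IHn]; first exact: Qg.
    by rewrite [LHS]iterS IHn; exact: Qg.
  rewrite image_set1 ereal_inf1 /L1_norm Lnorm1.
  by under eq_integral do rewrite /= subrr normr0; rewrite integral0.
rewrite (_ : [set _ | _ in _] = [set 0%E]) ?ereal_sup1//.
apply/seteqP; split => [_ [h dh <-]|_ ->]; first exact: dist0.
by exists g => //; exact: dist0.
Qed.

(** * Absorbing sets and condition (D) *)

(** If almost surely neither A nor its complement is ever left, then P^n(x, A)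
    is the indicator of A at every time. Knowing this at all points x, and not
    only on A, makes the integrand of the recursion an explicit measurable
    function. *)
Lemma transition_iter_dirac d (X : measurableType d) (R : realType)
    (P : X -> {measure set X -> \bar R}) (A : set X) :
  measurable A -> (forall x, P x A = \d_x A) ->
  forall n x, transition_iter P n x A = \d_x A.
Proof.
move=> mA PA; elim=> [//|[//|n] IHn] x.
rewrite -[LHS]/(\int[P x]_y transition_iter P n.+1 y A)%E.
under eq_integral => y _ do rewrite IHn diracE -indicE.
by rewrite integral_indic// setIT PA.
Qed.

(** A chain started in A stays there with probability 1 at all times, although
    every mu absolutely continuous with respect to m gives mass 0 to A. *)
Lemma not_condition_D d (X : measurableType d) (R : realType)
    (m : probability X R) (P : X -> {measure set X -> \bar R}) (A : set X)
    (x : X) :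
  measurable A -> m A = 0%E -> A x -> (forall y, P y A = \d_y A) ->
  ~ condition_D m P.
Proof.
move=> mA mA0 Ax PA [n [e [delta [mu [_ /andP[_ e1] delta0 mum PDe]]]]].
have muA0 : mu A = 0%E by move/null_content_dominatesP : mum; exact.
have := PDe x A mA; rewrite muA0 lte_fin => /(_ delta0).
rewrite transition_iter_dirac// diracE mem_set//= lte_fin.
by rewrite ltNge (ltW e1).
Qed.

(** * The random rotation with an absorbing origin *)

Section shift_transition.
Context (R : realType) (f0 : {mfun unit_interval R >-> unit_interval R}).
Local Notation m := (@lebesgue01 R).
Local Notation P := (transition_kernel m (shift_map f0)).

Lemma shift_transition_neq0 x A : measurable A -> x <> unit0 R ->
  P x A = m A.
Proof.
move=> mA /eqP x0; rewrite -(lebesgue01_rotation (f0 x) mA).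
rewrite /transition_kernel/= /transition_prob.
congr lebesgue01; apply/seteqP; split => t /=;
  by rewrite /shift_map/= (negbTE x0).
Qed.

(** Every f_t fixes the origin, and from any other point the next one is
    uniform, so that it avoids the origin almost surely. *)
Lemma shift_transition_set0 x : P x [set unit0 R] = \d_x [set unit0 R].
Proof.
have [->|x0] := eqVneq x (unit0 R).
  rewrite diracE mem_set// -(probability_setT m).
  rewrite /transition_kernel/= /transition_prob.
  by congr lebesgue01; apply/seteqP; split => t//= _; rewrite /shift_map/= eqxx.
rewrite shift_transition_neq0; [|exact: measurable_unit_set1|exact/eqP].
by rewrite diracE memNset ?lebesgue01_set1//; exact/eqP.
Qed.

Lemma shift_transition_ae A : measurable A -> \forall x \ae m, P x A = m A.
Proof.
move=> mA; exists [set unit0 R]; split.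
- exact: measurable_unit_set1.
- exact: lebesgue01_set1.
- move=> x /=; apply: contra_notP => x0.
  exact: shift_transition_neq0.
Qed.

End shift_transition.

Theorem proposition1p13 (R : realType)
    (f0 : {mfun unit_interval R >-> unit_interval R}) :
  let m : probability (unit_interval R) R := @lebesgue01 R in
  let p : probability (unit_interval R) R := @lebesgue01 R in
  let P : R.-pker unit_interval R ~> unit_interval R :=
    transition_kernel p (shift_map f0) in
  [/\ annealed_nonsingular m P,
      uniformly_constrictive m (annealed_PF m P) &
      ~ condition_D m P].
Proof.
move=> m p P.
have Pm A : measurable A -> \forall x \ae m, P x A = m A.
  exact: shift_transition_ae.
split.
- exact: annealed_nonsingular_of_ae.
- apply: (uniformly_constrictive_cst (L1_cst1_density m)) => h dh.
  by rewrite (annealed_PF_cst Pm) density_Rintegral.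
- apply: (not_condition_D (A := [set unit0 R]) (x := unit0 R)) => //.
  + exact: measurable_unit_set1.
  + exact: lebesgue01_set1.
  + exact: shift_transition_set0.
Qed.
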